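(* Let $$R=\begin{bmatrix}1&-\mathbf j&-q\mathbf j&-\mathbf j&1&-1&-1\\-1&1&-\mathbf j&-q\mathbf j&-\mathbf j&1&-1\\-1&-1&1&-\mathbf j&-q\mathbf j&-\mathbf j&1\\1&-1&-1&1&-\mathbf j&-q\mathbf j&-\mathbf j\\-\mathbf j&1&-1&-1&1&-\mathbf j&-q\mathbf j\\-q\mathbf j&-\mathbf j&1&-1&-1&1&-\mathbf j\\-\mathbf j&-q\mathbf j&-\mathbf j&1&-1&-1&1\end{bmatrix},$$ $$S=\begin{bmatrix}1&1&1&1&1&1&1\\1&-\mathbf kq\mathbf j&-\mathbf kq\mathbf k&\mathbf kq&\mathbf kq\mathbf k&\mathbf kq\mathbf j&(\mathbf kq)^2\\1&-q^*\mathbf i&\mathbf i&-\mathbf k&\mathbf k&-\mathbf i&\mathbf iq\\1&-1&\mathbf jq^*\mathbf j&\mathbf k&-\mathbf j&-\mathbf k&q\\1&\mathbf i&-1&-\mathbf iq^*\mathbf j&-\mathbf k&\mathbf k&\mathbf kq\\1&-\mathbf j&\mathbf j&-1&-\mathbf iq^*\mathbf i&\mathbf i&-q\\1&-\mathbf i&-\mathbf j&\mathbf i&-1&\mathbf jq^*\mathbf k&-\mathbf iq\end{bmatrix},$$ $$T=\begin{bmatrix}1&1&1&1&1&1&1\\1&\mathbf iq^*&\mathbf kq\mathbf j&-1&-\mathbf i&\mathbf k&\mathbf i\\1&-q^*&-\mathbf i&-\mathbf iq\mathbf i&-1&-\mathbf k&\mathbf k\\1&-\mathbf jq^*&-\mathbf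 j&\mathbf j&-\mathbf iq\mathbf k&-1&-\mathbf i\\1&q^*&\mathbf j&\mathbf k&-\mathbf j&\mathbf kq\mathbf k&-1\\1&-\mathbf iq^*&\mathbf i&-\mathbf j&\mathbf j&-\mathbf i&q\mathbf i\\1&(\mathbf jq^* )^2&\mathbf jq^*\mathbf k&\mathbf jq^*\mathbf j&-\mathbf jq^*&-\mathbf jq^*\mathbf j&-\mathbf jq^*\mathbf k\end{bmatrix}.$$ The quaternionic Hadamard matrix $R$ is neither equivalent to the quaternionic Hadamard matrix $S$ nor to the quaternionic Hadamard matrix $T$.
   Context: $\mathbb H$ is the real algebra of quaternions with basic units $\mathbf i,\mathbf j,\mathbf k$ ($\mathbf i\mathbf j=\mathbf k=-\mathbf j\mathbf i$, squares equal to $-1$), $x\mapsto x^*$ is quaternion conjugation, and $q=(1+\mathbf i+\mathbf j+\mathbf k)/2$. A quaternionic Hadamard matrix (QHM) of order $n$ is an $n\times n$ matrix $G$ with unit-norm quaternion entries such that $GG^*=nI_n$, where $G^*$ is the conjugate transpose. Two QHMs are equivalent if one can be obtained from the other by multiplying rows on the left by unit quaternions, multiplying columns on the right by unit quaternions, interchanging rows, or interchanging columns. *)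

(* Defs.v *)
From HB Require Import structures.
From mathcomp Require Import all_boot all_order all_algebra.
From mathcomp Require Import reals.
From mathcomp Require Import ring.
From Stdlib Require Import Relation_Operators.

Set Implicit Arguments.
Unset Strict Implicit.
Unset Printing Implicit Defensive.

Import GRing.Theory.
Local Open Scope ring_scope.

(* Quat a b c d stands for a + b i + c j + d k. *)
Record quaternion (F : Type) : Type :=
  Quat { qre : F; qim_i : F; qim_j : F; qim_k : F }.

Definition prod_of_quaternion (F : Type) (x : quaternion F) : F * F * F * F :=
  (qre x, qim_i x, qim_j x, qim_k x).

Definition quaternion_of_prod (F : Type) (t : F * F * F * F) : quaternion F :=
  let: (a, b, c, d) := t in Quat a b c d.

Lemma prod_of_quaternionK (F : Type) :
  cancel (@prod_of_quaternion F) (@quaternion_of_prod F).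
Proof. by case. Qed.

HB.instance Definition _ (F : eqType) :=
  Equality.copy (quaternion F) (can_type (@prod_of_quaternionK F)).
HB.instance Definition _ (F : choiceType) :=
  Choice.copy (quaternion F) (can_type (@prod_of_quaternionK F)).

Section QuaternionAlgebra.
Variable F : comNzRingType.
Implicit Types x y z : quaternion F.

Definition quat_add x y : quaternion F :=
  Quat (qre x + qre y) (qim_i x + qim_i y) (qim_j x + qim_j y)
       (qim_k x + qim_k y).

Definition quat_opp x : quaternion F :=
  Quat (- qre x) (- qim_i x) (- qim_j x) (- qim_k x).

Lemma quat_addA : associative quat_add.
Proof. by case=> ? ? ? ? [? ? ? ?] [? ? ? ?]; rewrite /quat_add /= !addrA. Qed.

Lemma quat_addC : commutative quat_add.
Proof. by case=> ? ? ? ? [? ? ? ?]; congr Quat; rewrite /= addrC. Qed.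

Lemma quat_add0 : left_id (Quat 0 0 0 0) quat_add.
Proof. by case=> ? ? ? ?; rewrite /quat_add /= !add0r. Qed.

Lemma quat_addN : left_inverse (Quat 0 0 0 0) quat_opp quat_add.
Proof. by case=> ? ? ? ?; rewrite /quat_add /= !addNr. Qed.

HB.instance Definition _ :=
  GRing.isZmodule.Build (quaternion F) quat_addA quat_addC quat_add0 quat_addN.

Definition quat_mul x y : quaternion F :=
  let: Quat a1 b1 c1 d1 := x in
  let: Quat a2 b2 c2 d2 := y in
  Quat (a1 * a2 - b1 * b2 - c1 * c2 - d1 * d2)
       (a1 * b2 + b1 * a2 + c1 * d2 - d1 * c2)
       (a1 * c2 - b1 * d2 + c1 * a2 + d1 * b2)
       (a1 * d2 + b1 * c2 - c1 * b2 + d1 * a2).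

Lemma quat_mulA : associative quat_mul.
Proof. by case=> ? ? ? ? [? ? ? ?] [? ? ? ?]; congr Quat; ring. Qed.

Lemma quat_1mul : left_id (Quat 1 0 0 0) quat_mul.
Proof. by case=> ? ? ? ?; congr Quat; ring. Qed.

Lemma quat_mul1 : right_id (Quat 1 0 0 0) quat_mul.
Proof. by case=> ? ? ? ?; congr Quat; ring. Qed.

Lemma quat_mulDl : left_distributive quat_mul +%R.
Proof. by case=> ? ? ? ? [? ? ? ?] [? ? ? ?]; congr Quat => /=; ring. Qed.

Lemma quat_mulDr : right_distributive quat_mul +%R.
Proof. by case=> ? ? ? ? [? ? ? ?] [? ? ? ?]; congr Quat => /=; ring. Qed.

Lemma quat_oner_neq0 : Quat 1 0 0 0 != 0 :> quaternion F.
Proof. by apply/eqP => -[] /eqP; rewrite oner_eq0. Qed.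

HB.instance Definition _ := GRing.Zmodule_isNzRing.Build (quaternion F)
  quat_mulA quat_1mul quat_mul1 quat_mulDl quat_mulDr quat_oner_neq0.

Definition quat_scale (r : F) x : quaternion F :=
  Quat (r * qre x) (r * qim_i x) (r * qim_j x) (r * qim_k x).

Lemma quat_scaleA a b x : quat_scale a (quat_scale b x) = quat_scale (a * b) x.
Proof. by rewrite /quat_scale /= !mulrA. Qed.

Lemma quat_scale1 : left_id 1 quat_scale.
Proof. by case=> ? ? ? ?; rewrite /quat_scale /= !mul1r. Qed.

Lemma quat_scaleDr : right_distributive quat_scale +%R.
Proof. by move=> r [? ? ? ?] [? ? ? ?]; congr Quat; rewrite /= mulrDr. Qed.

Lemma quat_scaleDl x : {morph quat_scale^~ x : a b / a + b}.
Proof. by case: x => ? ? ? ? a b; congr Quat; rewrite /= mulrDl. Qed.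

HB.instance Definition _ := GRing.Zmodule_isLmodule.Build F (quaternion F)
  quat_scaleA quat_scale1 quat_scaleDr quat_scaleDl.

Lemma quat_scaleAl (r : F) x y : r *: (x * y) = r *: x * y.
Proof. by case: x y => ? ? ? ? [? ? ? ?]; congr Quat => /=; ring. Qed.

HB.instance Definition _ :=
  GRing.Lmodule_isLalgebra.Build F (quaternion F) quat_scaleAl.

Lemma quat_scaleAr (r : F) x y : r *: (x * y) = x * (r *: y).
Proof. by case: x y => ? ? ? ? [? ? ? ?]; congr Quat => /=; ring. Qed.

HB.instance Definition _ :=
  GRing.Lalgebra_isAlgebra.Build F (quaternion F) quat_scaleAr.

Definition unit_i : quaternion F := Quat 0 1 0 0.
Definition unit_j : quaternion F := Quat 0 0 1 0.
Definition unit_k : quaternion F := Quat 0 0 0 1.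

Definition quat_conj x : quaternion F :=
  Quat (qre x) (- qim_i x) (- qim_j x) (- qim_k x).

End QuaternionAlgebra.

Section QuaternionicHadamard.
Variable F : realType.
Local Notation H := (quaternion F).

Definition quat_norm (x : H) : F :=
  Num.sqrt (qre x ^+ 2 + qim_i x ^+ 2 + qim_j x ^+ 2 + qim_k x ^+ 2).

Definition adjoint_mx (m n : nat) (A : 'M[H]_(m, n)) : 'M[H]_(n, m) :=
  map_mx (@quat_conj F) A^T.

Definition is_QHM (n : nat) (G : 'M[H]_n) : Prop :=
  (forall i j, quat_norm (G i j) = 1) /\ G *m adjoint_mx G = (n%:R)%:M.

Inductive QHM_move (n : nat) (A : 'M[H]_n) : 'M[H]_n -> Prop :=
| move_scale_row (i0 : 'I_n) (u : H) : quat_norm u = 1 ->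
    QHM_move A (\matrix_(i, j) (if i == i0 then u * A i j else A i j))
| move_scale_col (j0 : 'I_n) (u : H) : quat_norm u = 1 ->
    QHM_move A (\matrix_(i, j) (if j == j0 then A i j * u else A i j))
| move_swap_rows (i1 i2 : 'I_n) : QHM_move A (xrow i1 i2 A)
| move_swap_cols (j1 j2 : 'I_n) : QHM_move A (xcol j1 j2 A).

(* Every move is undone by a move, so the reflexive-transitive closure is
   already symmetric. *)
Definition QHM_equiv (n : nat) : 'M[H]_n -> 'M[H]_n -> Prop :=
  clos_refl_trans 'M[H]_n (@QHM_move n).

Definition mx7_of_rows (rows : seq (seq H)) : 'M[H]_7 :=
  \matrix_(r < 7, c < 7) nth 0 (nth [::] rows r) c.

Definition q_unit : H := 2^-1 *: (1 + unit_i F + unit_j F + unit_k F).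

Local Notation i := (unit_i F).
Local Notation j := (unit_j F).
Local Notation k := (unit_k F).
Local Notation q := q_unit.
Local Notation qs := (quat_conj q_unit).

Definition QHM_R : 'M[H]_7 := mx7_of_rows
  [:: [:: 1;        - j;      - (q * j); - j;       1;         - 1;       - 1];
      [:: - 1;      1;        - j;       - (q * j); - j;       1;         - 1];
      [:: - 1;      - 1;      1;         - j;       - (q * j); - j;       1];
      [:: 1;        - 1;      - 1;       1;         - j;       - (q * j); - j];
      [:: - j;      1;        - 1;       - 1;       1;         - j;       - (q * j)];
      [:: - (q * j); - j;     1;         - 1;       - 1;       1;         - j];
      [:: - j;      - (q * j); - j;      1;         - 1;       - 1;       1]].

Definition QHM_S : 'M[H]_7 := mx7_of_rows
  [:: [:: 1; 1; 1; 1; 1; 1; 1];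
      [:: 1; - (k * q * j); - (k * q * k); k * q; k * q * k; k * q * j;
          (k * q) ^+ 2];
      [:: 1; - (qs * i); i; - k; k; - i; i * q];
      [:: 1; - 1; j * qs * j; k; - j; - k; q];
      [:: 1; i; - 1; - (i * qs * j); - k; k; k * q];
      [:: 1; - j; j; - 1; - (i * qs * i); i; - q];
      [:: 1; - i; - j; i; - 1; j * qs * k; - (i * q)]].

Definition QHM_T : 'M[H]_7 := mx7_of_rows
  [:: [:: 1; 1; 1; 1; 1; 1; 1];
      [:: 1; i * qs; k * q * j; - 1; - i; k; i];
      [:: 1; - qs; - i; - (i * q * i); - 1; - k; k];
      [:: 1; - (j * qs); - j; j; - (i * q * k); - 1; - i];
      [:: 1; qs; j; k; - j; k * q * k; - 1];
      [:: 1; - (i * qs); i; - j; j; - i; q * i];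
      [:: 1; (j * qs) ^+ 2; j * qs * k; j * qs * j; - (j * qs);
          - (j * qs * j); - (j * qs * k)]].

End QuaternionicHadamard.

(* Main.v *)
(* If rows a, b and columns c, d of a quaternionic Hadamard matrix G satisfy
   G_ac (G_bc)^* = G_ad (G_bd)^*, then the corresponding rows and columns of
   every equivalent matrix do as well: a unit column factor cancels in each
   product, and row factors u_a, u_b multiply both sides by u_a on the left and
   by u_b^* on the right. Such a pair of rows and pair of columns exists in R
   (for instance a = 0, b = 1, c = 0, d = 5), but neither in S nor in T. All
   entries being halves of integral quaternions, the verifications reduce to
   computations over the integers. *)

Require Import Defs.
From mathcomp Require Import all_boot all_order all_fingroup all_algebra.
From mathcomp Require Import reals.
From mathcomp Require Import ring.
From Stdlib Require Import Relation_Operators.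

Set Implicit Arguments.
Unset Strict Implicit.
Unset Printing Implicit Defensive.

Import Order.TTheory GRing.Theory Num.Theory.
Local Open Scope ring_scope.

Lemma quat_conjM (F : comNzRingType) (x y : quaternion F) :
  quat_conj (x * y) = quat_conj y * quat_conj x.
Proof. by case: x y => ? ? ? ? [? ? ? ?]; congr Quat => /=; ring. Qed.

(** The product of [x] with its conjugate is the real sum of squares under the root, so the norm
    condition becomes a ring identity that needs no square roots. *)
Lemma quat_norm1P (F : realType) (x : quaternion F) :
  quat_norm x = 1 <-> x * quat_conj x = 1.
Proof.
case: x => a b c d; rewrite /quat_norm /=.
set s := a ^+ 2 + _ + _ + _.
have -> : Quat a b c d * quat_conj (Quat a b c d) = Quat s 0 0 0.
  by congr Quat => /=; rewrite /s; ring.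
split=> [s1|[->]]; last exact: sqrtr1.
have s_ge0 : 0 <= s by rewrite /s !addr_ge0 ?sqr_ge0.
by rewrite -[s]sqr_sqrtr // s1 expr1n.
Qed.

(** * The invariant and its preservation under the moves *)

(** For unit entries the conjugate is the inverse, so the equation says that, restricted to columns
    [c] and [d], row [a] is a left multiple of row [b]. *)
Definition has_proportional_minor (F : comNzRingType) (n : nat)
    (G : 'M[quaternion F]_n) : Prop :=
  exists a b c d : 'I_n, [/\ a != b, c != d &
    G a c * quat_conj (G b c) = G a d * quat_conj (G b d)].

Lemma proportional_minor_scale (F : comNzRingType) (n : nat)
    (u v : 'I_n -> quaternion F) (G : 'M[quaternion F]_n) :
  (forall c, v c * quat_conj (v c) = 1) -> has_proportional_minor G ->
  has_proportional_minor (\matrix_(a, c) (u a * G a c * v c)).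
Proof.
move=> v1 [a] [b] [c] [d] [ab cd eqG]; exists a, b, c, d; split=> //.
have scaledE e : u a * G a e * v e * quat_conj (u b * G b e * v e) =
    u a * (G a e * quat_conj (G b e)) * quat_conj (u b).
  by rewrite !quat_conjM !mulrA -(mulrA _ (v e)) v1 mulr1.
by rewrite !mxE !scaledE eqG.
Qed.

Lemma proportional_minor_reindex (F : comNzRingType) (n : nat)
    (s t : 'S_n) (G : 'M[quaternion F]_n) :
  has_proportional_minor G ->
  has_proportional_minor (row_perm s (col_perm t G)).
Proof.
move=> [a] [b] [c] [d] [ab cd eqG].
(* The permuted matrix has entry [G (s x) (t y)] at [(x, y)], so preimages of the old indices
   recover the old entries. *)
exists (s^-1 a)%g, (s^-1 b)%g, (t^-1 c)%g, (t^-1 d)%g.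
by rewrite !(inj_eq perm_inj) !mxE !permKV.
Qed.

Lemma proportional_minor_equiv (F : realType) (n : nat)
    (A B : 'M[quaternion F]_n) :
  QHM_equiv A B -> has_proportional_minor A -> has_proportional_minor B.
Proof.
(* Reflexivity and transitivity are settled at once; a single move remains. Scalings are treated as
   diagonal scalings with all other factors 1, interchanges as transpositions. *)
elim=> [{}A {}B|//|{}A C {}B _ IH1 _ IH2 /IH1 /IH2 //].
have conj1 : quat_conj 1 = 1 :> quaternion F by congr Quat; rewrite /= oppr0.
case=> [i0 u u1|j0 u u1|i1 i2|j1 j2] minorA.
- have unit_v (c : 'I_n) : (1 : quaternion F) * quat_conj 1 = 1 :> quaternion F.
    by rewrite conj1 mulr1.
  have := proportional_minor_scale
    (fun a => if a == i0 then u else 1) unit_v minorA.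
  congr has_proportional_minor; apply/matrixP=> a c; rewrite !mxE mulr1.
  by case: eqP => // _; rewrite mul1r.
- have unit_v c (v := if c == j0 then u else 1) : v * quat_conj v = 1.
    by rewrite /v; case: eqP => _; [exact/quat_norm1P|rewrite conj1 mulr1].
  have := proportional_minor_scale (fun=> 1) unit_v minorA.
  congr has_proportional_minor; apply/matrixP=> a c; rewrite !mxE mul1r.
  by case: eqP => // _; rewrite mulr1.
- have := proportional_minor_reindex (tperm i1 i2) 1%g minorA.
  by rewrite col_perm1.
- have := proportional_minor_reindex 1%g (tperm j1 j2) minorA.
  by rewrite row_perm1.
Qed.

(** * Reduction to integer quaternions *)

Definition halved (F : realType) (x : quaternion int) : quaternion F :=
  Quat ((qre x)%:~R / 2) ((qim_i x)%:~R / 2) ((qim_j x)%:~R / 2)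
       ((qim_k x)%:~R / 2).

(** The scale of a product of two [halved] values: the numerators multiply over the integers and the
    denominator is 4. *)
Definition quarter (F : realType) (x : quaternion int) : quaternion F :=
  Quat ((qre x)%:~R / 4) ((qim_i x)%:~R / 4) ((qim_j x)%:~R / 4)
       ((qim_k x)%:~R / 4).

Lemma halved_mul_conj (F : realType) (x y : quaternion int) :
  halved F x * quat_conj (halved F y) = quarter F (x * quat_conj y).
Proof.
case: x y => a b c d [a' b' c' d'].
by congr Quat; rewrite /= ?(intrD, intrB, intrM, mulrNz); field.
Qed.

Lemma quarterD (F : realType) : {morph quarter F : x y / x + y}.
Proof. by move=> x y; congr Quat; rewrite /= intrD mulrDl. Qed.

Lemma quarter0 (F : realType) : quarter F 0 = 0.
Proof. by congr Quat; rewrite /= mul0r. Qed.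

Lemma quarter_nat (F : realType) (n : nat) :
  quarter F (Quat (4 * n)%:Z 0 0 0) = n%:R.
Proof.
(* On the left [n%:R] is an iterated sum of the quaternion 1; its coordinates are found by
   induction. *)
have -> : n%:R = Quat n%:R 0 0 0 :> quaternion F.
  elim: n => [|n IHn]; first by [].
  by rewrite -natr1 IHn; congr Quat; rewrite /= ?addr0 // natr1.
by congr Quat; rewrite /= ?mul0r // PoszM intrM -!pmulrn; field.
Qed.

Lemma quarter_inj (F : realType) : injective (quarter F).
Proof.
have four_unit : (4 : F) \is a GRing.unit by rewrite unitfE pnatr_eq0.
case=> a b c d [a' b' c' d'] [].
by do 4![move/(divIr four_unit)/intr_inj=> ->].
Qed.

Definition entry (t : seq (seq (quaternion int))) (a c : nat) :
  quaternion int := nth 0 (nth [::] t a) c.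

Definition row_product (t : seq (seq (quaternion int))) (a b : nat) :
    quaternion int :=
  foldr +%R 0 [seq entry t a c * quat_conj (entry t b c) | c <- iota 0 7].

(** Doubling both factors multiplies each product by 4, so the targets 1 and 7 become [4 * 1] and
    [4 * 7], in the form that [quarter_nat] rewrites. *)
Definition doubled_is_QHM (t : seq (seq (quaternion int))) : bool :=
  all (fun a => all (fun b =>
    (entry t a b * quat_conj (entry t a b) == Quat (4 * 1)%N%:Z 0 0 0) &&
    (row_product t a b == if a == b then Quat (4 * 7)%N%:Z 0 0 0 else 0))
  (iota 0 7)) (iota 0 7).

Definition doubled_has_proportional_minor
    (t : seq (seq (quaternion int))) : bool :=
  has (fun a => has (fun b => has (fun c => has (fun d =>
    [&& a != b, c != d & entry t a c * quat_conj (entry t b c) ==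
                         entry t a d * quat_conj (entry t b d)])
  (iota 0 7)) (iota 0 7)) (iota 0 7)) (iota 0 7).

Lemma mx7_halvedE (F : realType) (t : seq (seq (quaternion int)))
    (a c : 'I_7) :
  mx7_of_rows (map (map (halved F)) t) a c = halved F (entry t a c).
Proof.
(* The table [t] may be too short, so the default value 0 must be fixed by [halved]. *)
have halved0 : halved F 0 = 0 by congr Quat; rewrite /= mul0r.
have nth_halved s m : nth 0 (map (halved F) s) m = halved F (nth 0 s m).
  have [lt_ms|le_sm] := ltnP m (size s); first exact: nth_map.
  by rewrite !nth_default ?size_map.
rewrite mxE /entry -nth_halved; congr (nth 0 _ c).
have [lt_at|le_ta] := ltnP a (size t); first exact: nth_map.
by rewrite !nth_default ?size_map.
Qed.

Lemma mem_iota7 (a : 'I_7) : (a : nat) \in iota 0 7.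
Proof. by rewrite mem_iota ltn_ord. Qed.

Lemma halved_is_QHM (F : realType) (t : seq (seq (quaternion int))) :
  doubled_is_QHM t -> is_QHM (mx7_of_rows (map (map (halved F)) t)).
Proof.
move=> t_QHM.
have tP (a b : 'I_7) :=
  andP (allP (allP t_QHM _ (mem_iota7 a)) _ (mem_iota7 b)).
split=> [a b|].
  apply/quat_norm1P; rewrite mx7_halvedE halved_mul_conj.
  by case: (tP a b) => /eqP-> _; rewrite quarter_nat.
apply/matrixP=> a b; rewrite !mxE.
under eq_bigr do rewrite 2![in X in _ * X]mxE !mx7_halvedE halved_mul_conj.
(* Additivity takes [quarter] out of the sum; the integer sum left, taken over a range of naturals,
   unfolds to the [foldr] of [row_product]. *)
rewrite -(big_morph _ (quarterD F) (quarter0 F)).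
rewrite -(big_mkord xpredT (fun c => entry t a c * quat_conj (entry t b c))).
have -> : \sum_(0 <= c < 7) entry t a c * quat_conj (entry t b c) =
    row_product t a b by rewrite unlock.
case: (tP a b) => _ /eqP->; rewrite -val_eqE; case: eqP => _ /=.
  by rewrite quarter_nat.
exact: quarter0.
Qed.

(** Since [quarter] is injective, the equation over [F] is the integer one. Right to left serves R;
    left to right excludes S and T. *)
Lemma halved_proportional_minorP (F : realType)
    (t : seq (seq (quaternion int))) :
  has_proportional_minor (mx7_of_rows (map (map (halved F)) t)) <->
  doubled_has_proportional_minor t.
Proof.
split=> [[a] [b] [c] [d] [ab cd]|].
  rewrite !mx7_halvedE !halved_mul_conj => /quarter_inj eq_t.
  apply/hasP; exists (a : nat); first exact: mem_iota7.
  apply/hasP; exists (b : nat); first exact: mem_iota7.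
  apply/hasP; exists (c : nat); first exact: mem_iota7.
  apply/hasP; exists (d : nat); first exact: mem_iota7.
  by rewrite eq_t eqxx andbT; apply/andP.
move=> /hasP[a]; rewrite mem_iota => /andP[_ lt_a].
move=> /hasP[b]; rewrite mem_iota => /andP[_ lt_b].
move=> /hasP[c]; rewrite mem_iota => /andP[_ lt_c].
move=> /hasP[d]; rewrite mem_iota => /andP[_ lt_d] /and3P[ab cd /eqP eq_t].
exists (Ordinal lt_a), (Ordinal lt_b), (Ordinal lt_c), (Ordinal lt_d).
by rewrite !mx7_halvedE !halved_mul_conj /= eq_t.
Qed.

(* [doubled_X] lists the rows of 2 X, where X is R, S or T. *)
Local Notation Hw a b c d := (Quat a%Z b%Z c%Z d%Z).

Definition doubled_R : seq (seq (quaternion int)) :=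
  [:: [:: Hw 2 0 0 0; Hw 0 0 (-2) 0; Hw 1 1 (-1) (-1);
          Hw 0 0 (-2) 0; Hw 2 0 0 0; Hw (-2) 0 0 0;
          Hw (-2) 0 0 0];
      [:: Hw (-2) 0 0 0; Hw 2 0 0 0; Hw 0 0 (-2) 0;
          Hw 1 1 (-1) (-1); Hw 0 0 (-2) 0; Hw 2 0 0 0;
          Hw (-2) 0 0 0];
      [:: Hw (-2) 0 0 0; Hw (-2) 0 0 0; Hw 2 0 0 0;
          Hw 0 0 (-2) 0; Hw 1 1 (-1) (-1); Hw 0 0 (-2) 0;
          Hw 2 0 0 0];
      [:: Hw 2 0 0 0; Hw (-2) 0 0 0; Hw (-2) 0 0 0;
          Hw 2 0 0 0; Hw 0 0 (-2) 0; Hw 1 1 (-1) (-1);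
          Hw 0 0 (-2) 0];
      [:: Hw 0 0 (-2) 0; Hw 2 0 0 0; Hw (-2) 0 0 0;
          Hw (-2) 0 0 0; Hw 2 0 0 0; Hw 0 0 (-2) 0;
          Hw 1 1 (-1) (-1)];
      [:: Hw 1 1 (-1) (-1); Hw 0 0 (-2) 0; Hw 2 0 0 0;
          Hw (-2) 0 0 0; Hw (-2) 0 0 0; Hw 2 0 0 0;
          Hw 0 0 (-2) 0];
      [:: Hw 0 0 (-2) 0; Hw 1 1 (-1) (-1); Hw 0 0 (-2) 0;
          Hw 2 0 0 0; Hw (-2) 0 0 0; Hw (-2) 0 0 0;
          Hw 2 0 0 0]].

Definition doubled_S : seq (seq (quaternion int)) :=
  [:: [:: Hw 2 0 0 0; Hw 2 0 0 0; Hw 2 0 0 0;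
          Hw 2 0 0 0; Hw 2 0 0 0; Hw 2 0 0 0;
          Hw 2 0 0 0];
      [:: Hw 2 0 0 0; Hw 1 1 1 1; Hw 1 (-1) (-1) 1;
          Hw (-1) (-1) 1 1; Hw (-1) 1 1 (-1); Hw (-1) (-1) (-1) (-1);
          Hw (-1) 1 (-1) (-1)];
      [:: Hw 2 0 0 0; Hw (-1) (-1) 1 (-1); Hw 0 2 0 0;
          Hw 0 0 0 (-2); Hw 0 0 0 2; Hw 0 (-2) 0 0;
          Hw (-1) 1 (-1) 1];
      [:: Hw 2 0 0 0; Hw (-2) 0 0 0; Hw (-1) (-1) 1 (-1);
          Hw 0 0 0 2; Hw 0 0 (-2) 0; Hw 0 0 0 (-2);
          Hw 1 1 1 1];
      [:: Hw 2 0 0 0; Hw 0 2 0 0; Hw (-2) 0 0 0;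
          Hw 1 (-1) (-1) (-1); Hw 0 0 0 (-2); Hw 0 0 0 2;
          Hw (-1) (-1) 1 1];
      [:: Hw 2 0 0 0; Hw 0 0 (-2) 0; Hw 0 0 2 0;
          Hw (-2) 0 0 0; Hw 1 (-1) 1 1; Hw 0 2 0 0;
          Hw (-1) (-1) (-1) (-1)];
      [:: Hw 2 0 0 0; Hw 0 (-2) 0 0; Hw 0 0 (-2) 0;
          Hw 0 2 0 0; Hw (-2) 0 0 0; Hw (-1) 1 1 1;
          Hw 1 (-1) 1 (-1)]].

Definition doubled_T : seq (seq (quaternion int)) :=
  [:: [:: Hw 2 0 0 0; Hw 2 0 0 0; Hw 2 0 0 0;
          Hw 2 0 0 0; Hw 2 0 0 0; Hw 2 0 0 0;
          Hw 2 0 0 0];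
      [:: Hw 2 0 0 0; Hw 1 1 1 (-1); Hw (-1) (-1) (-1) (-1);
          Hw (-2) 0 0 0; Hw 0 (-2) 0 0; Hw 0 0 0 2;
          Hw 0 2 0 0];
      [:: Hw 2 0 0 0; Hw (-1) 1 1 1; Hw 0 (-2) 0 0;
          Hw 1 1 (-1) (-1); Hw (-2) 0 0 0; Hw 0 0 0 (-2);
          Hw 0 0 0 2];
      [:: Hw 2 0 0 0; Hw (-1) 1 (-1) (-1); Hw 0 0 (-2) 0;
          Hw 0 0 2 0; Hw 1 1 1 1; Hw (-2) 0 0 0;
          Hw 0 (-2) 0 0];
      [:: Hw 2 0 0 0; Hw 1 (-1) (-1) (-1); Hw 0 0 2 0;
          Hw 0 0 0 2; Hw 0 0 (-2) 0; Hw (-1) 1 1 (-1);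
          Hw (-2) 0 0 0];
      [:: Hw 2 0 0 0; Hw (-1) (-1) (-1) 1; Hw 0 2 0 0;
          Hw 0 0 (-2) 0; Hw 0 0 2 0; Hw 0 (-2) 0 0;
          Hw (-1) 1 1 (-1)];
      [:: Hw 2 0 0 0; Hw (-1) (-1) 1 1; Hw (-1) 1 1 1;
          Hw (-1) (-1) 1 (-1); Hw (-1) 1 (-1) (-1); Hw 1 1 (-1) 1;
          Hw 1 (-1) (-1) (-1)]].

Lemma QHM_halved (F : realType) :
  [/\ QHM_R F = mx7_of_rows (map (map (halved F)) doubled_R),
      QHM_S F = mx7_of_rows (map (map (halved F)) doubled_S) &
      QHM_T F = mx7_of_rows (map (map (halved F)) doubled_T)].
Proof.
(* Each product of basic units and [q] is expanded and compared coordinate by coordinate. *)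
by split; congr mx7_of_rows; do ![congr cons]; congr Quat => /=; field.
Qed.

Theorem proposition23 (F : realType) :
  [/\ is_QHM (QHM_R F), is_QHM (QHM_S F) & is_QHM (QHM_T F)] /\
  ~ QHM_equiv (QHM_R F) (QHM_S F) /\ ~ QHM_equiv (QHM_R F) (QHM_T F).
Proof.
have [-> -> ->] := QHM_halved F; split.
  by split; apply: halved_is_QHM; vm_compute.
have minorR :
    has_proportional_minor (mx7_of_rows (map (map (halved F)) doubled_R)).
  by apply/halved_proportional_minorP; vm_compute.
(* An equivalence would carry the minor of R over, but the search through all index quadruples of
   the target table evaluates to false. *)
by split=> /proportional_minor_equiv/(_ minorR)/halved_proportional_minorP;
  vm_compute.
Qed.
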